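(* Let $R$ be a commutative ring. If $(X,\mathcal B)=(\mathrm{Spec}(R),\{D(f):f\in R\})$, where $D(f)=\{P\in\mathrm{Spec}(R):f\notin P\}$, then $E(X,\mathcal B)$ is isomorphic in the category $\mathfrak T$, naturally in $R$, to $(\mathrm{NCSpec}(R),\{\widetilde{U_f}:f\in R\})$.
   Context: The category $\mathfrak T$: a base $\mathcal B$ of a topological space $X$ is multiplicative if $X\in\mathcal B$ and $B_1\cap B_2\in\mathcal B$ for all $B_1,B_2\in\mathcal B$. Objects of $\mathfrak T$ are pairs $(X,\mathcal B)$ with $X$ a $T_0$ space and $\mathcal B$ a multiplicative base of $X$; morphisms $(X,\mathcal B)\to(Y,\mathcal C)$ are functions $f:X\to Y$ with $f^{-1}(C)\in\mathcal B$ for all $C\in\mathcal C$. The functor $E:\mathfrak T\to\mathfrak T$: for $(X,\mathcal B)\in\mathfrak T$ let $\mathcal P(X)$ be the power set of $X$, topologized with base $\{\widetilde B_0:B\in\mathcal B\}$, $\widetilde B_0=\{A\in\mathcal P(X):A\subset B\}$. Let $A\sim A'$ if $A$ and $A'$ lie in the same open subsets of $\mathcal P(X)$. $E(X,\mathcal B)$ is $\mathcal P(X)/{\sim}$ with the quotient topology and the multiplicative base $\{\widetilde B:B\in\mathcal B\}$, $\widetilde B=\{[A]:A\subset B\}$. On morphisms $E(f)([A])=[f(A)]$. $\mathrm{NCSpec}(R)$ as a topological space: rings are unital, the zero ring is allowed, and homomorphisms preserve $1$. For a finite subset $A$ of $R$, $\alpha_A:R\to loc(R,A)$ is the universal ring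 homomorphism sending each element of $A$ to a unit. Write $A\preceq B$ if $\alpha_B(a)$ is a unit for all $a\in A$. $L(R)$ is the poset of classes $R_A$ of finite subsets $A\subset R$ under the equivalence relation associated with the preorder $\preceq$, so $R_A\le R_B\iff A\preceq B$. Give $L(R)$ the Alexandrov topology (open sets are the upper sets), with basic open sets $U_A=\{R_F:R_F\ge R_A\}$. $\mathrm{NCSpec}(R)$ is the soberification $S(L(R))$: the set of irreducible (in particular nonempty) closed subsets of $L(R)$ with open sets $\widetilde U=\{C:C\cap U\neq\varnothing\}$, $U$ open in $L(R)$. For $f\in R$, $R_f:=R_{\{f\}}$ and $U_f:=U_{\{f\}}$; for $R$ commutative every element of $L(R)$ is of the form $R_f$ with $f\in R$. Functoriality in $R$: for a homomorphism $\theta:R\to S$ of commutative rings, the map $\mathrm{NCSpec}(S)\to\mathrm{NCSpec}(R)$ is $C\mapsto\{R_A\in L(R):S_{\theta(A)}\in C\}$, and $\mathrm{Spec}(S)\to\mathrm{Spec}(R)$ is the usual map $P\mapsto\theta^{-1}(P)$. *)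

(* Defs.v *)
From HB Require Import structures.
From mathcomp Require Import all_boot all_order all_algebra finmap.
From mathcomp Require Import generic_quotient.
From mathcomp Require Import boolp classical_sets topology.

Set Implicit Arguments.
Unset Strict Implicit.
Unset Printing Implicit Defensive.

Import Order.TTheory GRing.Theory.

Local Open Scope classical_set_scope.
Local Open Scope ring_scope.
Local Open Scope quotient_scope.

(* Rings are [pzRingType]s throughout, so that the zero ring is allowed. *)

Definition multiplicative (X : Type) (B : set (set X)) : Prop :=
  B setT /\ forall B1 B2, B B1 -> B B2 -> B (B1 `&` B2).

(* Objects and morphisms of the category of T0 spaces equipped with a
   multiplicative base. *)
Record tobj := TObj {
  tspace :> topologicalType;
  tbase : set (set tspace);
  tobj_T0 : kolmogorov_space tspace;
  tbase_basis : basis tbase;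
  tbase_mult : multiplicative tbase }.

Record thom (X Y : tobj) := THom {
  thom_fun :> X -> Y;
  thomP : forall C, tbase C -> tbase (thom_fun @^-1` C) }.

Lemma thom_eq (X Y : tobj) (f g : thom X Y) : f =1 g -> f = g.
Proof.
case: f g => [f fP] [g gP] /= /funext fg; case: _ / fg in gP *.
by congr THom; exact: Prop_irrelevance.
Qed.

Definition tid (X : tobj) : thom X X := @THom X X id (fun _ h => h).

Definition tcomp (X Y Z : tobj) (g : thom Y Z) (f : thom X Y) : thom X Z :=
  @THom X Z (g \o f) (fun C h => thomP f (thomP g h)).

Definition tiso (X Y : tobj) (f : thom X Y) : Prop :=
  exists g : thom Y X, tcomp g f = tid X /\ tcomp f g = tid Y.

Lemma kolmogorov_spaceI (T : topologicalType) :
  (forall x y : T, (forall U : set T, open U -> U x <-> U y) -> x = y) ->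
  kolmogorov_space T.
Proof.
move=> sep x y nxy; apply: contrapT => no; move/eqP: nxy; apply.
apply: sep => U oU; split=> Ux; apply: contrapT => nUy; apply: no; exists U.
- by left; rewrite !inE; split=> //; apply: open_nbhs_nbhs.
- by right; rewrite !inE; split=> //; apply: open_nbhs_nbhs.
Qed.

Lemma basisI (T : topologicalType) (B : set (set T)) :
  (forall U, B U -> open U) ->
  (forall U x, open U -> U x -> exists V, [/\ B V, V x & V `<=` U]) ->
  basis B.
Proof.
move=> Bo BU; split=> // x A; rewrite nbhsE => -[U [oU Ux] UA].
have [V [BV Vx VU]] := BU _ _ oU Ux.
by exists V => //=; apply: subset_trans VU UA.
Qed.

Lemma basis_mem (T : topologicalType) (B : set (set T)) U x :
  basis B -> open U -> U x -> exists V, [/\ B V, V x & V `<=` U].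
Proof.
move=> [_ Bx] oU Ux; have /(Bx x) [V /= [BV Vx] VU] : nbhs x U.
  exact: open_nbhs_nbhs.
by exists V.
Qed.

Definition pow_space (X : tobj) : Type := set X.
HB.instance Definition _ (X : tobj) := Choice.on (pow_space X).

Definition pow_box (X : tobj) (B : set X) : set (pow_space X) :=
  [set A : set X | A `<=` B].

Section PowSpace.
Variable X : tobj.

Lemma pow_box_cover : \bigcup_(B in @tbase X) pow_box B = setT.
Proof.
by apply/seteqP; split=> // A _; exists setT => //; case: (tbase_mult X).
Qed.

Lemma pow_box_join (B1 B2 : set X) (A : pow_space X) :
  tbase B1 -> tbase B2 -> pow_box B1 A -> pow_box B2 A ->
  exists B, [/\ tbase B, pow_box B A & pow_box B `<=` pow_box B1 `&` pow_box B2].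
Proof.
move=> b1 b2 A1 A2; exists (B1 `&` B2); split.
- by case: (tbase_mult X) => _; apply.
- by move=> x Ax; split; [apply: A1|apply: A2].
- by move=> A' A'B; split=> x /A'B [].
Qed.

HB.instance Definition _ := @isBaseTopological.Build (pow_space X)
  (set X) (@tbase X) (@pow_box X) pow_box_cover pow_box_join.

Lemma pow_box_open (B : set X) : tbase B -> open (@pow_box X B).
Proof.
move=> bB; exists [set B]; first by move=> _ ->.
by rewrite bigcup_set1.
Qed.

Lemma pow_openP (U : set (pow_space X)) (A : pow_space X) : open U -> U A ->
  exists B, [/\ tbase B, pow_box B A & pow_box B `<=` U].
Proof.
move=> [D DB <-] [B DBB AB]; exists B; split=> //; first exact: DB.
by move=> A' A'B; exists B.
Qed.

Definition pow_equiv (A A' : pow_space X) : Prop :=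
  forall U : set (pow_space X), open U -> (U A <-> U A').

Definition pow_eqb (A A' : pow_space X) : bool := `[< pow_equiv A A' >].

Lemma pow_eqb_refl : reflexive pow_eqb.
Proof. by move=> A; apply/asboolP. Qed.

Lemma pow_eqb_sym : symmetric pow_eqb.
Proof.
by move=> A A'; apply/asboolP/asboolP => h U oU; split=> /(h _ oU).
Qed.

Lemma pow_eqb_trans : transitive pow_eqb.
Proof.
move=> A2 A1 A3 /asboolP h1 /asboolP h2; apply/asboolP => U oU.
exact: iff_trans (h1 _ oU) (h2 _ oU).
Qed.

Canonical pow_eqb_equiv := EquivRel pow_eqb pow_eqb_refl pow_eqb_sym pow_eqb_trans.

Definition E_space : topologicalType := quotient_topology {eq_quot pow_eqb}.

Definition E_class (A : set X) : E_space := \pi_{eq_quot pow_eqb} (A : pow_space X).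

Lemma E_classP (A A' : set X) : E_class A = E_class A' <-> pow_equiv A A'.
Proof. by split=> [/eqmodP /asboolP|h]; last by apply/eqmodP/asboolP. Qed.

Lemma E_class_surj (q : E_space) : exists A, q = E_class A.
Proof. by exists (repr q); rewrite /E_class reprK. Qed.

Lemma pow_equivP (A A' : set X) :
  pow_equiv A A' <-> forall B, tbase B -> (A `<=` B <-> A' `<=` B).
Proof.
split=> [h B bB|h U oU]; first exact: (h _ (pow_box_open bB)).
by split=> /(pow_openP oU) [B [bB AB]]; apply; apply/(h _ bB).
Qed.

Definition E_box (B : set X) : set E_space :=
  [set E_class A | A in [set A : set X | A `<=` B]].

Definition E_base : set (set E_space) := [set E_box B | B in @tbase X].

Lemma E_boxE (A B : set X) : tbase B -> E_box B (E_class A) <-> A `<=` B.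
Proof.
move=> bB; split=> [[A' A'B /E_classP /pow_equivP h]|]; last by exists A.
by apply/(h _ bB).
Qed.

Lemma E_box_open (B : set X) : tbase B -> open (E_box B).
Proof.
move=> bB; rewrite /open /= /quotient_open.
rewrite (_ : _ @^-1` _ = pow_box B); first exact: pow_box_open.
by apply/seteqP; split=> A; have [] := E_boxE A bB.
Qed.

Lemma E_T0 : kolmogorov_space E_space.
Proof.
apply: kolmogorov_spaceI => x y.
have [A ->] := E_class_surj x; have [A' ->] := E_class_surj y => h.
apply/E_classP/pow_equivP => B bB.
by rewrite -!(E_boxE _ bB); apply: h; apply: E_box_open.
Qed.

Lemma E_basis : basis E_base.
Proof.
apply: basisI => [_ [B bB <-]|U x oU]; first exact: E_box_open.
have [A ->] := E_class_surj x => UA.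
have [B [bB AB BU]] := pow_openP oU UA.
exists (E_box B); split; [by exists B|by apply/E_boxE|].
by move=> _ [A' A'B <-]; exact: BU.
Qed.

Lemma E_mult : multiplicative E_base.
Proof.
have [bT bI] := tbase_mult X; split.
  exists setT => //; apply/seteqP; split=> // q _.
  by have [A ->] := E_class_surj q; apply/E_boxE.
move=> _ _ [B1 b1 <-] [B2 b2 <-]; exists (B1 `&` B2); first exact: bI.
apply/seteqP; split=> q; have [A ->] := E_class_surj q.
  by move/(E_boxE A (bI _ _ b1 b2)); rewrite subsetI => -[??];
     split; apply/E_boxE.
by move=> [/(E_boxE A b1)? /(E_boxE A b2)?]; apply/E_boxE;
   [exact: bI|rewrite subsetI].
Qed.

Definition E_obj : tobj := TObj E_T0 E_basis E_mult.

End PowSpace.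

Section EMap.
Variables (X Y : tobj) (f : thom X Y).

Definition E_fun (q : E_obj X) : E_obj Y := E_class (f @` repr q).

Lemma E_funE (A : set X) : E_fun (E_class A) = E_class (f @` A).
Proof.
apply/E_classP/pow_equivP => C bC.
have : pow_equiv (repr (E_class A)) A by apply/E_classP; rewrite /E_class reprK.
move/pow_equivP => /(_ _ (thomP f bC)) h.
by rewrite !image_sub.
Qed.

Lemma E_fun_base (C : set (E_obj Y)) : tbase C -> tbase (E_fun @^-1` C).
Proof.
move=> [B bB <-]; exists (f @^-1` B); first exact: thomP.
have bfB := thomP f bB.
apply/seteqP; split=> q; have [A ->] := E_class_surj q.
  by move/(E_boxE A bfB) => AB; rewrite /= E_funE E_boxE// image_sub.
by rewrite /= E_funE E_boxE// image_sub => AB; apply/E_boxE.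
Qed.

Definition E_map : thom (E_obj X) (E_obj Y) := THom E_fun_base.

End EMap.

Definition is_unit (R : pzRingType) (x : R) : Prop :=
  exists y, y * x = 1 /\ x * y = 1.

Lemma is_unit_morph (R S : pzRingType) (f : {rmorphism R -> S}) x :
  is_unit x -> is_unit (f x).
Proof.
by move=> [y [yx xy]]; exists (f y); rewrite -!rmorphM yx xy rmorph1.
Qed.

(* [loc A] is presented by generators and relations over R: one new generator
   for each element of A, which is forced to be its two-sided inverse. *)
Inductive loc_term (R : pzRingType) (A : {fset R}) : Type :=
| LConst of R
| LInv of A
| LAdd of loc_term A & loc_term A
| LOpp of loc_term A
| LMul of loc_term A & loc_term A.
Arguments LConst {R A} _.
Arguments LInv {R A} _.

HB.instance Definition _ (R : pzRingType) (A : {fset R}) :=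
  gen_eqMixin (loc_term A).
HB.instance Definition _ (R : pzRingType) (A : {fset R}) :=
  gen_choiceMixin (loc_term A).

Inductive loc_rel (R : pzRingType) (A : {fset R}) :
    loc_term A -> loc_term A -> Prop :=
| lr_refl s : loc_rel s s
| lr_sym s t : loc_rel s t -> loc_rel t s
| lr_trans s t u : loc_rel s t -> loc_rel t u -> loc_rel s u
| lr_add s s' t t' : loc_rel s s' -> loc_rel t t' ->
    loc_rel (LAdd s t) (LAdd s' t')
| lr_opp s s' : loc_rel s s' -> loc_rel (LOpp s) (LOpp s')
| lr_mul s s' t t' : loc_rel s s' -> loc_rel t t' ->
    loc_rel (LMul s t) (LMul s' t')
| lr_addA s t u : loc_rel (LAdd s (LAdd t u)) (LAdd (LAdd s t) u)
| lr_addC s t : loc_rel (LAdd s t) (LAdd t s)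
| lr_add0 s : loc_rel (LAdd (LConst 0) s) s
| lr_addN s : loc_rel (LAdd (LOpp s) s) (LConst 0)
| lr_mulA s t u : loc_rel (LMul s (LMul t u)) (LMul (LMul s t) u)
| lr_mul1l s : loc_rel (LMul (LConst 1) s) s
| lr_mul1r s : loc_rel (LMul s (LConst 1)) s
| lr_mulDl s t u : loc_rel (LMul (LAdd s t) u) (LAdd (LMul s u) (LMul t u))
| lr_mulDr s t u : loc_rel (LMul s (LAdd t u)) (LAdd (LMul s t) (LMul s u))
| lr_constD r r' : loc_rel (LConst (r + r')) (LAdd (LConst r) (LConst r'))
| lr_constM r r' : loc_rel (LConst (r * r')) (LMul (LConst r) (LConst r'))
| lr_invl (a : A) : loc_rel (LMul (LInv a) (LConst (val a))) (LConst 1)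
| lr_invr (a : A) : loc_rel (LMul (LConst (val a)) (LInv a)) (LConst 1).

Section Loc.
Variables (R : pzRingType) (A : {fset R}).
Local Notation term := (loc_term A).

Definition loc_eqb (s t : term) : bool := `[< loc_rel s t >].

Lemma loc_eqb_refl : reflexive loc_eqb.
Proof. by move=> s; apply/asboolP; exact: lr_refl. Qed.
Lemma loc_eqb_sym : symmetric loc_eqb.
Proof. by move=> s t; apply/asboolP/asboolP; exact: lr_sym. Qed.
Lemma loc_eqb_trans : transitive loc_eqb.
Proof.
by move=> t s u /asboolP h1 /asboolP h2; apply/asboolP; exact: lr_trans h1 h2.
Qed.

Canonical loc_eqb_equiv := EquivRel loc_eqb loc_eqb_refl loc_eqb_sym loc_eqb_trans.

Definition loc : Type := {eq_quot loc_eqb}.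
HB.instance Definition _ := Choice.on loc.

Definition loc_class (s : term) : loc := \pi_{eq_quot loc_eqb} s.

Lemma loc_classP s t : loc_class s = loc_class t <-> loc_rel s t.
Proof. by split=> [/eqmodP /asboolP|h]; last by apply/eqmodP/asboolP. Qed.

Lemma loc_reprK x : loc_class (repr x) = x.
Proof. by rewrite /loc_class reprK. Qed.

Lemma loc_rel_repr s : loc_rel (repr (loc_class s)) s.
Proof. by apply/loc_classP; rewrite loc_reprK. Qed.

Lemma loc_surj x : exists s, x = loc_class s.
Proof. by exists (repr x); rewrite loc_reprK. Qed.

Definition loc_add (x y : loc) : loc := loc_class (LAdd (repr x) (repr y)).
Definition loc_opp (x : loc) : loc := loc_class (LOpp (repr x)).
Definition loc_mul (x y : loc) : loc := loc_class (LMul (repr x) (repr y)).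

Lemma loc_addE s t : loc_add (loc_class s) (loc_class t) = loc_class (LAdd s t).
Proof. by apply/loc_classP; apply: lr_add; exact: loc_rel_repr. Qed.
Lemma loc_oppE s : loc_opp (loc_class s) = loc_class (LOpp s).
Proof. by apply/loc_classP; apply: lr_opp; exact: loc_rel_repr. Qed.
Lemma loc_mulE s t : loc_mul (loc_class s) (loc_class t) = loc_class (LMul s t).
Proof. by apply/loc_classP; apply: lr_mul; exact: loc_rel_repr. Qed.

Local Ltac loc_ax l :=
  repeat (let x := fresh "x" in let s := fresh "s" in
          move=> x; case: (loc_surj x) => s ->);
  rewrite ?(loc_addE, loc_oppE, loc_mulE); apply/loc_classP; exact: l.

Let loc_addA : associative loc_add. Proof. by loc_ax lr_addA. Qed.
Let loc_addC : commutative loc_add. Proof. by loc_ax lr_addC. Qed.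
Let loc_add0 : left_id (loc_class (LConst 0)) loc_add.
Proof. by loc_ax lr_add0. Qed.
Let loc_addN : left_inverse (loc_class (LConst 0)) loc_opp loc_add.
Proof. by loc_ax lr_addN. Qed.
Let loc_mulA : associative loc_mul. Proof. by loc_ax lr_mulA. Qed.
Let loc_mul1l : left_id (loc_class (LConst 1)) loc_mul.
Proof. by loc_ax lr_mul1l. Qed.
Let loc_mul1r : right_id (loc_class (LConst 1)) loc_mul.
Proof. by loc_ax lr_mul1r. Qed.
Let loc_mulDl : left_distributive loc_mul loc_add.
Proof. by loc_ax lr_mulDl. Qed.
Let loc_mulDr : right_distributive loc_mul loc_add.
Proof. by loc_ax lr_mulDr. Qed.

HB.instance Definition _ := GRing.isZmodule.Build loc
  loc_addA loc_addC loc_add0 loc_addN.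
HB.instance Definition _ := GRing.Zmodule_isPzRing.Build loc
  loc_mulA loc_mul1l loc_mul1r loc_mulDl loc_mulDr.

Definition loc_map (r : R) : loc := loc_class (LConst r).

Lemma loc_map_zmod : zmod_morphism loc_map.
Proof.
have mapD r r' : loc_map (r + r') = loc_map r + loc_map r'.
  by rewrite [RHS]loc_addE; apply/loc_classP; exact: lr_constD.
by move=> r r'; apply/eqP; rewrite eq_sym subr_eq -mapD subrK.
Qed.

Lemma loc_map_monoid : monoid_morphism loc_map.
Proof.
split=> // r r'; rewrite [RHS]loc_mulE.
by apply/loc_classP; exact: lr_constM.
Qed.

HB.instance Definition _ := GRing.isZmodMorphism.Build R loc loc_map loc_map_zmod.
HB.instance Definition _ := GRing.isMonoidMorphism.Build R loc loc_map loc_map_monoid.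

Lemma loc_map_unit a : a \in A -> is_unit (loc_map a).
Proof.
move=> aA; exists (loc_class (LInv [` aA]%fset)).
by split; rewrite [LHS]loc_mulE; apply/loc_classP;
  [exact: (lr_invl [` aA]%fset)|exact: (lr_invr [` aA]%fset)].
Qed.

Section Universal.
Variables (S : pzRingType) (f : {rmorphism R -> S}).
Hypothesis funit : forall a, a \in A -> is_unit (f a).

Let finv (a : A) : S := projT1 (cid (funit (valP a))).
Let finvP (a : A) : finv a * f (val a) = 1 /\ f (val a) * finv a = 1.
Proof. exact: projT2 (cid (funit (valP a))). Qed.

Fixpoint loc_eval (s : term) : S :=
  match s with
  | LConst r => f r
  | LInv a => finv a
  | LAdd s t => loc_eval s + loc_eval t
  | LOpp s => - loc_eval s
  | LMul s t => loc_eval s * loc_eval t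
  end.

Lemma loc_eval_rel s t : loc_rel s t -> loc_eval s = loc_eval t.
Proof.
elim=> //=; try by [move=> *; congruence].
- by move=> *; rewrite addrA.
- by move=> *; rewrite addrC.
- by move=> *; rewrite rmorph0 add0r.
- by move=> *; rewrite rmorph0 addNr.
- by move=> *; rewrite mulrA.
- by move=> *; rewrite rmorph1 mul1r.
- by move=> *; rewrite rmorph1 mulr1.
- by move=> *; rewrite mulrDl.
- by move=> *; rewrite mulrDr.
- by move=> *; rewrite rmorphD.
- by move=> *; rewrite rmorphM.
- by move=> a; rewrite rmorph1; case: (finvP a).
- by move=> a; rewrite rmorph1; case: (finvP a).
Qed.

Definition loc_lift (x : loc) : S := loc_eval (repr x).

Lemma loc_liftE s : loc_lift (loc_class s) = loc_eval s.
Proof. by apply: loc_eval_rel; exact: loc_rel_repr. Qed.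

Lemma loc_lift_zmod : zmod_morphism loc_lift.
Proof.
move=> x y; have [s ->] := loc_surj x; have [t ->] := loc_surj y.
by rewrite [- _]loc_oppE [_ + _]loc_addE !loc_liftE.
Qed.

Lemma loc_lift_monoid : monoid_morphism loc_lift.
Proof.
split=> [|x y]; first by rewrite [1]/(loc_class _) loc_liftE /= rmorph1.
have [s ->] := loc_surj x; have [t ->] := loc_surj y.
by rewrite [_ * _]loc_mulE !loc_liftE.
Qed.

HB.instance Definition _ := GRing.isZmodMorphism.Build loc S loc_lift loc_lift_zmod.
HB.instance Definition _ := GRing.isMonoidMorphism.Build loc S loc_lift loc_lift_monoid.

Definition loc_lift_morph : {rmorphism loc -> S} := loc_lift.

End Universal.

Lemma loc_universal (S : pzRingType) (f : {rmorphism R -> S}) :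
  (forall a, a \in A -> is_unit (f a)) ->
  exists2 g : {rmorphism loc -> S}, (forall r, g (loc_map r) = f r) &
    forall h : {rmorphism loc -> S}, (forall r, h (loc_map r) = f r) -> h =1 g.
Proof.
move=> fu; exists (loc_lift_morph fu) => [r|h hf x]; first exact: loc_liftE.
have [s ->] := loc_surj x; rewrite [RHS]loc_liftE.
elim: s => /= [r|a|s IHs t IHt|s IHs|s IHs t IHt].
- exact: hf.
- case: (cid _) => /= y [yf fy].
  have : h (loc_class (LInv a)) * f (val a) = 1.
    rewrite -hf -rmorphM -(rmorph1 h); congr (h _).
    by rewrite [LHS]loc_mulE; apply/loc_classP; exact: lr_invl.
  by move/(congr1 ( *%R^~ y)); rewrite -mulrA fy mulr1 mul1r.
- by rewrite -loc_addE -IHs -IHt -rmorphD.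
- by rewrite -loc_oppE -IHs -rmorphN.
- by rewrite -loc_mulE -IHs -IHt -rmorphM.
Qed.

End Loc.

Section LocPoset.
Variable R : pzRingType.
Implicit Types A B C : {fset R}.

Definition loc_prec A B : Prop := forall a, a \in A -> is_unit (loc_map B a).

Lemma loc_prec_refl A : loc_prec A A.
Proof. by move=> a; exact: loc_map_unit. Qed.

Lemma loc_prec_trans A B C : loc_prec A B -> loc_prec B C -> loc_prec A C.
Proof.
move=> AB BC; have [g gE _] := loc_universal BC.
by move=> a /AB /(is_unit_morph g); rewrite gE.
Qed.

Definition loc_equivb A B : bool := `[< loc_prec A B /\ loc_prec B A >].

Lemma loc_equivb_refl : reflexive loc_equivb.
Proof. by move=> A; apply/asboolP; split; exact: loc_prec_refl. Qed.
Lemma loc_equivb_sym : symmetric loc_equivb.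
Proof. by move=> A B; apply/asboolP/asboolP => -[]. Qed.
Lemma loc_equivb_trans : transitive loc_equivb.
Proof.
move=> B A C /asboolP[AB BA] /asboolP[BC CB]; apply/asboolP.
by split; [exact: loc_prec_trans AB BC|exact: loc_prec_trans CB BA].
Qed.

Canonical loc_equivb_equiv :=
  EquivRel loc_equivb loc_equivb_refl loc_equivb_sym loc_equivb_trans.

Definition locset : Type := {eq_quot loc_equivb}.
HB.instance Definition _ := Choice.on locset.

Definition locset_class A : locset := \pi_{eq_quot loc_equivb} A.

Lemma locset_classP A B :
  locset_class A = locset_class B <-> loc_prec A B /\ loc_prec B A.
Proof. by split=> [/eqmodP /asboolP|h]; last by apply/eqmodP/asboolP. Qed.

Lemma locset_surj (x : locset) : exists A, x = locset_class A.
Proof. by exists (repr x); rewrite /locset_class reprK. Qed.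

Definition locset_le (x y : locset) : bool := `[< loc_prec (repr x) (repr y) >].

Lemma locset_leP A B :
  locset_le (locset_class A) (locset_class B) <-> loc_prec A B.
Proof.
have reprP C : loc_prec (repr (locset_class C)) C /\
               loc_prec C (repr (locset_class C)).
  by apply/locset_classP; rewrite /locset_class reprK.
have [[A1 A2] [B1 B2]] := (reprP A, reprP B).
split=> [/asboolP h|h]; last apply/asboolP.
  exact: loc_prec_trans A2 (loc_prec_trans h B1).
exact: loc_prec_trans A1 (loc_prec_trans h B2).
Qed.

Let locset_le_refl : reflexive locset_le.
Proof. by move=> x; apply/asboolP; exact: loc_prec_refl. Qed.
Let locset_le_anti : antisymmetric locset_le.
Proof.
move=> x y; have [A ->] := locset_surj x; have [B ->] := locset_surj y.
by move=> /andP[/locset_leP AB /locset_leP BA]; apply/locset_classP.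
Qed.
Let locset_le_trans : transitive locset_le.
Proof.
by move=> y x z /asboolP xy /asboolP yz; apply/asboolP; exact: loc_prec_trans xy yz.
Qed.

HB.instance Definition _ := @Order.Le_isPOrder.Build (Order.Disp tt tt) locset
  locset_le locset_le_refl locset_le_anti locset_le_trans.

Lemma le_locset A B : (locset_class A <= locset_class B)%O <-> loc_prec A B.
Proof. exact: locset_leP. Qed.

Lemma locset_join A B : exists C, [/\ (locset_class A <= locset_class C)%O,
  (locset_class B <= locset_class C)%O & forall D, loc_prec A D ->
  loc_prec B D -> loc_prec C D].
Proof.
exists (A `|` B)%fset; split.
- by apply/le_locset => a aA; apply: loc_map_unit; rewrite in_fsetU aA.
- by apply/le_locset => a aB; apply: loc_map_unit; rewrite in_fsetU aB orbT.
- by move=> D AD BD a; rewrite in_fsetU => /orP[/AD|/BD].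
Qed.

End LocPoset.

Section LocFunctor.
Variables (R S : pzRingType) (theta : {rmorphism R -> S}).

Definition img_fset (A : {fset R}) : {fset S} := [fset theta a | a in A]%fset.

Lemma loc_prec_img (A B : {fset R}) : loc_prec A B -> loc_prec (img_fset A) (img_fset B).
Proof.
move=> AB _ /imfsetP[a /= aA ->].
have [|g gE _] := @loc_universal _ B _ (loc_map (img_fset B) \o theta).
  by move=> b bB; apply: loc_map_unit; apply: in_imfset.
by have /(is_unit_morph g) := AB _ aA; rewrite gE.
Qed.

End LocFunctor.

Definition alexandrov (d : Order.disp_t) (P : porderType d) : Type := P.

Section Alexandrov.
Variables (d : Order.disp_t) (P : porderType d).

HB.instance Definition _ := Choice.on (alexandrov P).

Definition upper_set (U : set (alexandrov P)) : Prop :=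
  forall x y : P, (x <= y)%O -> U x -> U y.

Let upper_setT : upper_set setT. Proof. by []. Qed.
Let upper_setI : setI_closed upper_set.
Proof. by move=> U V uU uV x y xy [/(uU _ _ xy) ? /(uV _ _ xy) ?]. Qed.
Let upper_bigU (I : Type) (f : I -> set (alexandrov P)) :
  (forall i, upper_set (f i)) -> upper_set (\bigcup_i f i).
Proof. by move=> fu x y xy [i _ fx]; exists i => //; exact: fu fx. Qed.

HB.instance Definition _ := isOpenTopological.Build (alexandrov P)
  upper_setT upper_setI upper_bigU.

Lemma alexandrov_open (U : set (alexandrov P)) : open U = upper_set U.
Proof. by []. Qed.

Lemma alexandrov_closed (C : set (alexandrov P)) :
  closed C <-> forall x y : P, (x <= y)%O -> C y -> C x.
Proof.
rewrite -openC alexandrov_open; split=> h x y xy; last by apply: contra_not; exact: h.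
by move=> Cy; apply: contrapT => nCx; exact: (h _ _ xy nCx).
Qed.

End Alexandrov.

Definition irreducible_set (X : topologicalType) (C : set X) : Prop :=
  C !=set0 /\ forall F1 F2 : set X, closed F1 -> closed F2 ->
    C `<=` F1 `|` F2 -> C `<=` F1 \/ C `<=` F2.

Lemma alexandrov_irreducible d (P : porderType d) (C : set (alexandrov P)) :
  closed C -> irreducible_set C <->
    C !=set0 /\ forall x y : P, C x -> C y ->
      exists z : P, [/\ C z, (x <= z)%O & (y <= z)%O].
Proof.
move=> /alexandrov_closed cC; split=> -[C0 h]; split=> //.
  move=> x y Cx Cy; apply: contrapT => no.
  have cl (t : P) : closed [set z : alexandrov P | ~ (t <= z)%O].
    by apply/alexandrov_closed => u v uv; apply: contra_not => /le_trans; apply.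
  have [z Cz||] := h _ _ (cl x) (cl y).
  - apply: contrapT => /not_orP[/contrapT xz /contrapT yz].
    by apply: no; exists z.
  - by move/(_ _ Cx); apply.
  - by move/(_ _ Cy); apply.
move=> F1 F2 /alexandrov_closed c1 /alexandrov_closed c2 CF.
apply: contrapT => /not_orP[/existsNP[x /not_implyP[Cx n1]] /existsNP[y /not_implyP[Cy n2]]].
have [z [Cz xz yz]] := h _ _ Cx Cy.
by case: (CF _ Cz) => [/(c1 _ _ xz)|/(c2 _ _ yz)].
Qed.

Record sober (X : topologicalType) := Sober {
  sober_set :> set X;
  sober_closed : closed sober_set;
  sober_irr : irreducible_set sober_set }.
Arguments sober_closed {X} _ : rename.
Arguments sober_irr {X} _ : rename.

HB.instance Definition _ (X : topologicalType) := gen_eqMixin (sober X).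
HB.instance Definition _ (X : topologicalType) := gen_choiceMixin (sober X).

Lemma sober_eq (X : topologicalType) (C D : sober X) :
  sober_set C = sober_set D -> C = D.
Proof.
case: C D => [C c1 c2] [D d1 d2] /= CD; case: _ / CD in d1 d2 *.
by congr Sober; exact: Prop_irrelevance.
Qed.

Definition sober_hit (X : topologicalType) (U : set X) : set (sober X) :=
  [set C : sober X | C `&` U !=set0].

Section Sober.
Variable X : topologicalType.

Definition sober_open : set (set (sober X)) :=
  [set sober_hit U | U in [set U : set X | open U]].

Lemma sober_hitI (U V : set X) : open U -> open V ->
  sober_hit (U `&` V) = sober_hit U `&` sober_hit V.
Proof.
move=> oU oV; apply/seteqP; split=> C.
  by move=> [x [Cx [Ux Vx]]]; split; exists x.
move=> [[x [Cx Ux]] [y [Cy Vy]]]; apply: contrapT => no.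
have [_ irr] := sober_irr C.
have [z Cz|/(_ _ Cx)|/(_ _ Cy)] := irr (~` U) (~` V) (open_closedC oU)
    (open_closedC oV); [|by apply|by apply].
by apply: contrapT => /not_orP[/contrapT Uz /contrapT Vz]; apply: no; exists z.
Qed.

Let sober_openT : sober_open setT.
Proof.
exists setT; first exact: openT.
apply/seteqP; split=> // C _; have [[x Cx] _] := sober_irr C.
by exists x.
Qed.

Let sober_openI : setI_closed sober_open.
Proof.
move=> _ _ [U oU <-] [V oV <-]; exists (U `&` V); first exact: openI.
exact: sober_hitI.
Qed.

Let sober_bigU (I : Type) (f : I -> set (sober X)) :
  (forall i, sober_open (f i)) -> sober_open (\bigcup_i f i).
Proof.
move=> fo; pose g i := projT1 (cid2 (fo i)).
have gP i : open (g i) /\ sober_hit (g i) = f i.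
  by rewrite /g; case: (cid2 _).
exists (\bigcup_i g i); first by apply: bigcup_open => i _; case: (gP i).
apply/seteqP; split=> C.
  by move=> [x [Cx [i _ gx]]]; exists i => //; rewrite -(gP i).2; exists x.
by move=> [i _]; rewrite -(gP i).2 => -[x [Cx gx]]; exists x; split=> //; exists i.
Qed.

HB.instance Definition _ := isOpenTopological.Build (sober X)
  sober_openT sober_openI sober_bigU.

Lemma open_soberE (V : set (sober X)) : open V = sober_open V.
Proof. by []. Qed.

Lemma sober_hit_open (U : set X) : open U -> open (sober_hit U).
Proof. by move=> oU; exists U. Qed.

Lemma sober_T0 : kolmogorov_space (sober X).
Proof.
apply: kolmogorov_spaceI.
have sub (C D : sober X) : (forall V, open V -> V C <-> V D) -> C `<=` D.
  move=> h x Cx; apply: contrapT => nDx.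
  have oD : open (~` D) by rewrite openC; exact: sober_closed.
  have /(h _ (sober_hit_open oD)) [y [Dy nDy]] : sober_hit (~` D) C by exists x.
  exact: nDy.
move=> C D h; apply: sober_eq; apply/seteqP; split; apply: sub => // V oV.
exact: iff_sym (h V oV).
Qed.

End Sober.

Definition LR (R : pzRingType) : topologicalType := alexandrov (locset R).

Definition R_ (R : pzRingType) (A : {fset R}) : LR R := locset_class A.

Definition U_ (R : pzRingType) (A : {fset R}) : set (LR R) :=
  [set R_ F | F in [set F : {fset R} | (locset_class A <= locset_class F)%O]].

Notation NCSpec R := (sober (LR R)).

Section NCSpecTheory.
Variable R : pzRingType.
Implicit Types A B F : {fset R}.

Lemma U_E A F : U_ A (R_ F) <-> loc_prec A F.
Proof.
split=> [[F' /le_locset AF' /locset_classP[F'F _]]|AF].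
  exact: loc_prec_trans AF' F'F.
by exists F => //; apply/le_locset.
Qed.

Lemma U_open A : open (U_ A).
Proof.
rewrite alexandrov_open => x y; have [F ->] := locset_surj x.
have [G ->] := locset_surj y => /le_locset FG /U_E AF; apply/U_E.
exact: loc_prec_trans AF FG.
Qed.

Lemma NCSpec_down (C : NCSpec R) A B : loc_prec A B -> sober_set C (R_ B) -> sober_set C (R_ A).
Proof.
by move/le_locset; have /alexandrov_closed := sober_closed C; apply.
Qed.

Lemma NCSpec_directed (C : NCSpec R) A B : sober_set C (R_ A) -> sober_set C (R_ B) ->
  sober_set C (R_ (A `|` B)%fset).
Proof.
move=> CA CB; have [_ dir] := (alexandrov_irreducible (sober_closed C)).1 (sober_irr C).
have [z [Cz]] := dir _ _ CA CB.
have [F zE] := locset_surj z; rewrite zE in Cz *.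
move=> /le_locset AF /le_locset BF; apply: NCSpec_down Cz => a.
by rewrite in_fsetU => /orP[/AF|/BF].
Qed.

Lemma NCSpec_hitP (C : NCSpec R) A : sober_hit (U_ A) C <-> sober_set C (R_ A).
Proof.
split=> [[x [Cx]]|CA]; last first.
  by exists (R_ A); split=> //; apply/U_E; exact: loc_prec_refl.
by have [F xE] := locset_surj x; rewrite xE in Cx * => /U_E /NCSpec_down; apply.
Qed.

End NCSpecTheory.

Section NCSpecFun.
Variables (R S : pzRingType) (theta : {rmorphism R -> S}).

Definition NCSpec_fun_set (C : NCSpec S) : set (LR R) :=
  [set R_ A | A in [set A : {fset R} | sober_set C (R_ (img_fset theta A))]].

Lemma NCSpec_fun_setE (C : NCSpec S) (A : {fset R}) :
  NCSpec_fun_set C (R_ A) <-> sober_set C (R_ (img_fset theta A)).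
Proof.
split=> [[B CB /locset_classP[_ AB]]|]; last by exists A.
exact: NCSpec_down (loc_prec_img AB) CB.
Qed.

Lemma NCSpec_fun_closed (C : NCSpec S) : closed (NCSpec_fun_set C).
Proof.
apply/alexandrov_closed => x y; have [A ->] := locset_surj x.
have [B ->] := locset_surj y => /le_locset AB /NCSpec_fun_setE CB.
by apply/NCSpec_fun_setE; exact: NCSpec_down (loc_prec_img AB) CB.
Qed.

Arguments NCSpec_fun_closed : clear implicits.

Lemma NCSpec_fun_irr (C : NCSpec S) : irreducible_set (NCSpec_fun_set C).
Proof.
apply/(alexandrov_irreducible (NCSpec_fun_closed C)); split.
  exists (R_ fset0); apply/NCSpec_fun_setE.
  have [[x Cx] _] := sober_irr C; have [F xE] := locset_surj x.
  rewrite xE in Cx; apply: NCSpec_down Cx => b.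
  by rewrite /img_fset imfset0 inE.
move=> x y; have [A ->] := locset_surj x; have [B ->] := locset_surj y.
move=> /NCSpec_fun_setE CA /NCSpec_fun_setE CB.
exists (locset_class (A `|` B)%fset); split.
- apply/NCSpec_fun_setE; rewrite /img_fset imfsetU.
  exact: NCSpec_directed.
- by apply/le_locset => a aA; apply: loc_map_unit; rewrite in_fsetU aA.
- by apply/le_locset => a aB; apply: loc_map_unit; rewrite in_fsetU aB orbT.
Qed.

Definition NCSpec_fun (C : NCSpec S) : NCSpec R :=
  Sober (NCSpec_fun_closed C) (NCSpec_fun_irr C).

End NCSpecFun.

Section NCSpecT.
Variable R : comPzRingType.

Definition NCSpec_base : set (set (NCSpec R)) :=
  [set sober_hit (U_ [fset f]%fset) | f in [set: R]].

Lemma loc_prec1 (f : R) (B : {fset R}) :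
  loc_prec [fset f]%fset B <-> is_unit (loc_map B f).
Proof.
by split=> [|h a]; [apply; rewrite inE|rewrite inE => /eqP ->].
Qed.

Lemma is_unit_mapM (T : pzRingType) (h : {rmorphism R -> T}) (f g : R) :
  is_unit (h (f * g)) <-> is_unit (h f) /\ is_unit (h g).
Proof.
split=> [[u []]|[[u [uf fu]] [v [vg gv]]]]; last first.
  exists (v * u); rewrite rmorphM; split.
    by rewrite mulrA -(mulrA v) uf mulr1.
  by rewrite mulrA -(mulrA (h f)) gv mulr1.
have unitI (b x c : T) : b * x = 1 -> x * c = 1 -> is_unit x.
  move=> bx xc; exists b; split=> //.
  by rewrite (_ : b = c) // -[b]mulr1 -xc mulrA bx mul1r.
have fgC : h f * h g = h g * h f by rewrite -!rmorphM mulrC.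
rewrite rmorphM => u1 u2; split.
  by apply: (unitI (u * h g) _ (h g * u)); rewrite -?mulrA -?fgC // mulrA.
by apply: (unitI (u * h f) _ (h f * u)); rewrite ?mulrA -?fgC // -mulrA.
Qed.

Lemma LR_principal (A : {fset R}) : exists f : R, R_ A = R_ [fset f]%fset.
Proof.
pose f : R := \prod_(a <- A) a.
have fE (B : {fset R}) : loc_prec A B <-> is_unit (loc_map B f).
  rewrite /f /loc_prec; have -> : (forall a, a \in A -> is_unit (loc_map B a)) <->
      (forall a, a \in enum_fset A -> is_unit (loc_map B a)) by [].
  elim: (enum_fset A) => [|a s IH].
    by rewrite big_nil rmorph1; split=> // _; exists 1; rewrite !mulr1.
  rewrite big_cons is_unit_mapM -IH; split=> [h|[ha hs] b].
    by split=> [|b bs]; apply: h; rewrite inE ?eqxx ?bs ?orbT.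
  by rewrite inE => /predU1P[->//|/hs].
exists f; apply/locset_classP; split.
  by apply/fE; apply: loc_map_unit; rewrite inE.
by apply/loc_prec1/fE; exact: loc_prec_refl.
Qed.

Lemma NCSpec_basis : basis NCSpec_base.
Proof.
apply: basisI => [_ [f _ <-]|V C]; first exact/sober_hit_open/U_open.
move=> [U oU <-] [x [Cx Ux]]; have [A xE] := locset_surj x.
have [f fE] := LR_principal A; have {}xE : x = R_ [fset f]%fset by rewrite xE.
exists (sober_hit (U_ [fset f]%fset)); split; first by exists f.
  by apply/NCSpec_hitP; rewrite -xE.
by move=> D /NCSpec_hitP Df; exists x; split=> //; rewrite xE.
Qed.

Lemma NCSpec_mult : multiplicative NCSpec_base.
Proof.
split.
  exists 1 => //; apply/seteqP; split=> // C _; apply/NCSpec_hitP.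
  have [[x Cx] _] := sober_irr C; have [F xE] := locset_surj x.
  rewrite xE in Cx; apply: NCSpec_down Cx; apply/loc_prec1.
  by rewrite rmorph1; exists 1; rewrite !mulr1.
move=> _ _ [f _ <-] [g _ <-]; exists (f * g) => //.
rewrite -sober_hitI; try exact: U_open.
congr sober_hit; apply/seteqP; split=> x; have [F ->] := locset_surj x.
  by move=> /U_E/loc_prec1/is_unit_mapM[uf ug]; split; apply/U_E/loc_prec1.
move=> [/U_E/loc_prec1 uf /U_E/loc_prec1 ug].
by apply/U_E/loc_prec1/is_unit_mapM.
Qed.

Definition NCSpec_obj : tobj := TObj (@sober_T0 (LR R)) NCSpec_basis NCSpec_mult.

End NCSpecT.

Section NCSpecMap.
Variables (R S : comPzRingType) (theta : {rmorphism R -> S}).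

Lemma NCSpec_fun_base (V : set (NCSpec_obj R)) :
  tbase V -> @tbase (NCSpec_obj S) (NCSpec_fun theta @^-1` V).
Proof.
move=> [f _ <-]; exists (theta f) => //.
have imE : img_fset theta [fset f]%fset = [fset theta f]%fset.
  by rewrite /img_fset imfset_fset1.
apply/seteqP; split=> C /=.
  by move/NCSpec_hitP => Cf; apply/NCSpec_hitP/NCSpec_fun_setE; rewrite imE.
by move/NCSpec_hitP/NCSpec_fun_setE; rewrite imE => Cf; apply/NCSpec_hitP.
Qed.

Definition NCSpec_map : thom (NCSpec_obj S) (NCSpec_obj R) :=
  @THom (NCSpec_obj S) (NCSpec_obj R) (NCSpec_fun theta) NCSpec_fun_base.

End NCSpecMap.

(* The library's [prime_idealr_closed] is restricted to nonzero rings. *)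
Definition prime_ideal (R : comPzRingType) (P : set R) : Prop :=
  [/\ P 0, forall x y, P x -> P y -> P (x + y), forall a x, P x -> P (a * x),
      ~ P 1 & forall x y, P (x * y) -> P x \/ P y].

Record Spec (R : comPzRingType) := SpecPoint {
  spec_set :> set R;
  spec_prime : prime_ideal spec_set }.

HB.instance Definition _ (R : comPzRingType) := gen_eqMixin (Spec R).
HB.instance Definition _ (R : comPzRingType) := gen_choiceMixin (Spec R).

Lemma spec_eq (R : comPzRingType) (P Q : Spec R) :
  spec_set P = spec_set Q -> P = Q.
Proof.
case: P Q => [P p] [Q q] /= PQ; case: _ / PQ in q *.
by congr SpecPoint; exact: Prop_irrelevance.
Qed.

Definition D_ (R : comPzRingType) (f : R) : set (Spec R) := [set P | ~ spec_set P f].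

Section SpecTopology.
Variable R : comPzRingType.

Lemma spec_mul (P : Spec R) x y : spec_set P (x * y) <-> spec_set P x \/ spec_set P y.
Proof.
have [_ _ PM _ PP] := spec_prime P; split; first exact: PP.
by case=> [Px|]; [rewrite mulrC|]; exact: PM.
Qed.

Lemma D_1 : D_ (1 : R) = setT.
Proof. by apply/seteqP; split=> // P _; case: (spec_prime P). Qed.

Lemma D_M (f g : R) : D_ (f * g) = D_ f `&` D_ g.
Proof.
apply/seteqP; split=> P; rewrite /D_ /= spec_mul; first by move/not_orP.
by move=> [nf ng] [].
Qed.

(* [zariski E] is the complement of V(E) *)
Definition zariski (E : set R) : set (Spec R) := [set P | ~ E `<=` P].

Definition zariski_open : set (set (Spec R)) := range zariski.

Lemma zariskiE (E : set R) : zariski E = \bigcup_(f in E) D_ f.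
Proof.
apply/seteqP; split=> P; first by move=> /existsNP[f /not_implyP[Ef nPf]]; exists f.
by move=> [f Ef nPf] /(_ _ Ef).
Qed.

Let zariskiT : zariski_open setT.
Proof. by exists [set 1]; rewrite // zariskiE bigcup_set1 D_1. Qed.

Let zariskiI : setI_closed zariski_open.
Proof.
move=> _ _ [E _ <-] [F _ <-].
exists [set x * y | x in E & y in F] => //; rewrite !zariskiE.
apply/seteqP; split=> P.
  by move=> [_ [x Ex [y Fy <-]]]; rewrite D_M => -[nx ny]; split; [exists x|exists y].
by move=> [[x Ex nx] [y Fy ny]]; exists (x * y); [exists x => //; exists y|rewrite D_M].
Qed.

Let zariski_bigU (I : Type) (f : I -> set (Spec R)) :
  (forall i, zariski_open (f i)) -> zariski_open (\bigcup_i f i).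
Proof.
move=> fo; pose E i := projT1 (cid2 (fo i)).
have EP i : zariski (E i) = f i by rewrite /E; case: (cid2 _).
exists (\bigcup_i E i) => //; rewrite zariskiE.
apply/seteqP; split=> P.
  by move=> [x [i _ Ex] nx]; exists i => //; rewrite -EP zariskiE; exists x.
by move=> [i _]; rewrite -EP zariskiE => -[x Ex nx]; exists x => //; exists i.
Qed.

HB.instance Definition _ := isOpenTopological.Build (Spec R)
  zariskiT zariskiI zariski_bigU.

Lemma D_open (f : R) : open (D_ f).
Proof. by exists [set f] => //; rewrite zariskiE bigcup_set1. Qed.

Lemma Spec_T0 : kolmogorov_space (Spec R).
Proof.
apply: kolmogorov_spaceI => P Q h; apply: spec_eq; apply/seteqP.
by split=> f Pf; apply: contrapT => nPf; have [hP hQ] := h _ (D_open f);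
   [exact: hQ nPf Pf|exact: hP nPf Pf].
Qed.

Definition Spec_base : set (set (Spec R)) := [set D_ f | f in [set: R]].

Lemma Spec_basis : basis Spec_base.
Proof.
apply: basisI => [_ [f _ <-]|U P]; first exact: D_open.
move=> [E _ <-]; rewrite zariskiE => -[f Ef nPf]; exists (D_ f).
by split=> //; [exists f|move=> Q nQf; exists f].
Qed.

Lemma Spec_mult : multiplicative Spec_base.
Proof.
split; first by exists 1 => //; exact: D_1.
by move=> _ _ [f _ <-] [g _ <-]; exists (f * g) => //; exact: D_M.
Qed.

Definition Spec_obj : tobj := TObj Spec_T0 Spec_basis Spec_mult.

End SpecTopology.

Section SpecMap.
Variables (R S : comPzRingType) (theta : {rmorphism R -> S}).

Lemma prime_ideal_preimage (P : Spec S) : prime_ideal (theta @^-1` P).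
Proof.
have [P0 PD PM P1 PP] := spec_prime P; split; rewrite /= ?rmorph0 ?rmorph1 //.
- by move=> x y /= Px Py; rewrite rmorphD; exact: PD.
- by move=> a x /= Px; rewrite rmorphM; exact: PM.
- by move=> x y /=; rewrite rmorphM; exact: PP.
Qed.

Definition Spec_fun (P : Spec S) : Spec R := SpecPoint (prime_ideal_preimage P).

Lemma Spec_fun_base (U : set (Spec_obj R)) :
  tbase U -> @tbase (Spec_obj S) (Spec_fun @^-1` U).
Proof. by move=> [f _ <-]; exists (theta f). Qed.

Definition Spec_map : thom (Spec_obj S) (Spec_obj R) :=
  @THom (Spec_obj S) (Spec_obj R) Spec_fun Spec_fun_base.

End SpecMap.

(* Main.v *)
Require Import Defs.
From mathcomp Require Import all_boot all_algebra.
From mathcomp Require Import finmap boolp classical_sets topology ring.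

(** A point [A] of [E(Spec R)] is determined by the set of those [f] with
    [A `<=` D(f)], and an irreducible closed subset [C] of [L(R)] by the set of
    those [f] with [R_f] in [C].  The sets of the second kind are exactly the
    saturated multiplicative subsets of [R], those of the first kind exactly
    the complements of unions of primes; by Zorn's lemma, every saturated
    multiplicative set is such a complement.  That the [R_F] with [A `<=` D(f)]
    for all [f] in [F] form a closed subset of [L(R)] means that an element
    invertible in [loc(R, G)] lies in no prime disjoint from [G], as is seen by
    mapping to the residue field of the prime. *)

Set Implicit Arguments.
Unset Strict Implicit.
Unset Printing Implicit Defensive.

Import GRing.Theory.

Local Open Scope classical_set_scope.
Local Open Scope ring_scope.

(** * Prime ideals disjoint from a multiplicative set *)

Definition ideal (R : comPzRingType) (J : set R) : Prop :=
  [/\ J 0, forall x y, J x -> J y -> J (x + y) & forall a x, J x -> J (a * x)].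

Section PrimeDisjoint.
Variables (R : comPzRingType) (M : set R).
Hypothesis M1 : M 1.
Hypothesis MM : forall x y, M x -> M y -> M (x * y).

Lemma ideal_adjoin (J : set R) x : ideal J ->
  ideal [set y | exists2 p, J p & exists a, y = p + a * x].
Proof.
move=> [J0 JD JM]; split=> [|y z|b y].
- by exists 0 => //; exists 0; rewrite mul0r addr0.
- move=> [p Jp [a ->]] [q Jq [b ->]]; exists (p + q); first exact: JD.
  by exists (a + b); rewrite mulrDl addrACA.
- move=> [p Jp [a ->]]; exists (b * p); first exact: JM.
  by exists (b * a); rewrite mulrDr mulrA.
Qed.

Lemma maximal_disjoint_ideal (J : set R) : ideal J -> J `&` M = set0 ->
  exists K : set R, [/\ ideal K, J `<=` K, K `&` M = set0 &
    forall L : set R, ideal L -> K `<=` L -> L `&` M = set0 -> L `<=` K].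
Proof.
move=> Jid JM0.
(* Sets are joined with [J] so that the union of the empty chain qualifies. *)
pose good := [set X : set R | ideal (J `|` X) /\ (J `|` X) `&` M = set0].
have [F Fgood Ftot|A [[Aid AM0] Amax]] := @Zorn_bigcup R good.
  have [J0 JD JM] := Jid; split.
    split; [by left| |].
      move=> x y [Jx|[X FX Xx]] [Jy|[Y FY Yy]].
      - by left; apply: JD.
      - have [[_ YD _] _] := Fgood _ FY.
        have [|Yxy] := YD x y (or_introl Jx) (or_intror Yy); first by left.
        by right; exists Y.
      - have [[_ XD _] _] := Fgood _ FX.
        have [|Xxy] := XD x y (or_intror Xx) (or_introl Jy); first by left.
        by right; exists X.
      - wlog XY : x y X Y FX FY Xx Yy / (X `<=` Y).
          move=> hw; case: (Ftot _ _ FX FY) => XY; first exact: hw FX FY Xx Yy XY.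
          by rewrite addrC; exact: hw FY FX Yy Xx XY.
        have [[_ YD _] _] := Fgood _ FY.
        have [|Yxy] := YD x y (or_intror (XY _ Xx)) (or_intror Yy); first by left.
        by right; exists Y.
    move=> a x [Jx|[X FX Xx]]; first by left; apply: JM.
    have [[_ _ XM] _] := Fgood _ FX.
    have [|Xax] := XM a x (or_intror Xx); first by left.
    by right; exists X.
  apply/seteqP; split=> // x [[Jx|[X FX Xx]] Mx].
    by rewrite -JM0.
  by have [_ <-] := Fgood _ FX; split=> //; right.
exists (J `|` A); split=> // L Lid AL LM0 x Lx; apply: contrapT => nx.
have JL : J `|` L = L by apply/setUidPr => y Jy; apply: AL; left.
apply: (Amax L); last by rewrite /good /= JL.
split=> [y Ay|/(_ _ Lx) Ax]; first by apply: AL; right.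
by apply: nx; right.
Qed.

(** An ideal [K] maximal among those disjoint from [M] is prime: if [x] and [y] lie outside [K],
    then [K + Rx] and [K + Ry] both meet [M], and the product of the two common elements lies in [M]
    and in [K + Rxy], so [x * y] is not in [K]. *)
Lemma exists_prime_disjoint (J : set R) : ideal J -> J `&` M = set0 ->
  exists P : Spec R, J `<=` P /\ P `&` M = set0.
Proof.
move=> Jid JM0; have [K [Kid JK KM0 Kmax]] := maximal_disjoint_ideal Jid JM0.
have [K0 KD KM] := Kid.
have nKM x : K x -> ~ M x by move=> Kx Mx; have : (K `&` M) x by []; rewrite KM0.
have meet x : ~ K x -> exists2 p, K p & exists a, M (p + a * x).
  move=> nKx; apply: contrapT => no; apply: nKx.
  apply: (Kmax _ (ideal_adjoin x Kid)).
  - by move=> p Kp; exists p => //; exists 0; rewrite mul0r addr0.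
  - apply/seteqP; split=> // y [[p Kp [a ->]] Mpa].
    by apply: no; exists p => //; exists a.
  - by exists 0 => //; exists 1; rewrite mul1r add0r.
suff Kprime : prime_ideal K by exists (SpecPoint Kprime).
split=> //; first by move=> K1; exact: nKM K1 M1.
move=> x y Kxy; apply: contrapT => /not_orP[/meet [p Kp [a Mp]] /meet [q Kq [b Mq]]].
apply: nKM (MM Mp Mq).
rewrite mulrDl; apply: (KD _ _ _ _); first by rewrite mulrC; exact: KM.
by rewrite mulrDr mulrACA; apply: KD; exact: KM.
Qed.

End PrimeDisjoint.

(** * Units of a localization and primes *)

Section UnitsAtPrime.
Variables (R : comPzRingType) (G : {fset R}) (P : Spec R).
Hypothesis PG : forall g, g \in G -> ~ spec_set P g.

(* Terms of [loc G] are interpreted in the residue field of [P] by unreduced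
   fractions, which spares the construction of that field. *)
Fixpoint frac (t : loc_term G) : R * R :=
  match t with
  | LConst r => (r, 1)
  | LInv g => (1, val g)
  | LAdd s t => ((frac s).1 * (frac t).2 + (frac t).1 * (frac s).2,
                 (frac s).2 * (frac t).2)
  | LOpp s => (- (frac s).1, (frac s).2)
  | LMul s t => ((frac s).1 * (frac t).1, (frac s).2 * (frac t).2)
  end.

Lemma frac_den t : ~ spec_set P (frac t).2.
Proof.
elim: t => [r|g|s IHs t IHt|s IHs|s IHs t IHt] //=.
- by case: (spec_prime P).
- exact/PG/valP.
- by move/spec_mul => [].
- by move/spec_mul => [].
Qed.

(** Cross-multiplied, this is equality of the two fractions in the residue field of [P]. It goes by
    induction on the derivation; the ring axioms and the inverse relations become identities in
    [R]. *)
Lemma loc_rel_frac s t : loc_rel s t ->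
  spec_set P ((frac s).1 * (frac t).2 - (frac t).1 * (frac s).2).
Proof.
have [P0 PD PM _ _] := spec_prime P.
have PE x y : spec_set P x -> x = y -> spec_set P y by move=> ? <-.
have P0E x : x = 0 -> spec_set P x by move=> ->.
elim=> {s t}.
- by move=> s; apply: P0E; ring.
- by move=> s t _ /(PM (-1)) /PE; apply; ring.
- move=> s t u _ Pst _ Ptu.
  (* Transitivity is where primality enters: the denominator of the middle term has to be
     cancelled. *)
  have /spec_mul [|//] : spec_set P ((frac t).2 *
      ((frac s).1 * (frac u).2 - (frac u).1 * (frac s).2)).
    by apply: PE (PD _ _ (PM (frac u).2 _ Pst) (PM (frac s).2 _ Ptu)) _; ring.
  by move/frac_den.
- move=> s s' t t' _ Ps _ Pt /=.
  apply: PE (PD _ _ (PM ((frac t).2 * (frac t').2) _ Ps)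
    (PM ((frac s).2 * (frac s').2) _ Pt)) _; ring.
- by move=> s s' _ /(PM (-1)) /PE; apply => /=; ring.
- move=> s s' t t' _ Ps _ Pt /=.
  apply: PE (PD _ _ (PM ((frac t).1 * (frac t').2) _ Ps)
    (PM ((frac s').1 * (frac s).2) _ Pt)) _; ring.
all: by move=> *; apply: P0E => /=; ring.
Qed.

(** If a term [t] represents the inverse of [a], its numerator times [a] is congruent modulo [P] to
    its denominator; with [a] in [P], the denominator would lie in [P]. *)
Lemma unit_loc_notin_prime a : is_unit (loc_map G a) -> ~ spec_set P a.
Proof.
move=> [y [ya _]] Pa; have [t yE] := loc_surj y.
have [_ PD PM _ _] := spec_prime P.
have /loc_rel_frac /= Pta : loc_rel (LMul t (LConst a)) (LConst 1).
  by apply/loc_classP; rewrite -loc_mulE -yE.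
apply: (@frac_den t); rewrite (_ : (frac t).2 = (frac t).1 * a +
  -1 * ((frac t).1 * a * 1 - 1 * ((frac t).2 * 1))); last by ring.
by apply: PD; apply: PM.
Qed.

End UnitsAtPrime.

(** * The isomorphism and its inverse *)

Section Eta.
Variable R : comPzRingType.
Implicit Types (A : set (Spec R)) (F G : {fset R}).

Definition missed_by A F : Prop := forall f, f \in F -> A `<=` @D_ R f.

Lemma missed_by1 A (f : R) : missed_by A [fset f]%fset <-> A `<=` @D_ R f.
Proof. by split=> [|Af g]; [apply; rewrite inE|rewrite inE => /eqP ->]. Qed.

Lemma missed_by_prec A F G : loc_prec F G -> missed_by A G -> missed_by A F.
Proof.
move=> FG AG f /FG fu P AP; apply: unit_loc_notin_prime fu => g gG.
exact: AG gG _ AP.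
Qed.

Definition eta_set A : set (LR R) := [set R_ F | F in missed_by A].

Lemma eta_setE A F : eta_set A (R_ F) <-> missed_by A F.
Proof.
split=> [[G AG /locset_classP[_ FG]]|AF]; last by exists F.
exact: missed_by_prec FG AG.
Qed.

Lemma eta_closed A : closed (eta_set A).
Proof.
apply/alexandrov_closed => x y; have [F ->] := locset_surj x.
have [G ->] := locset_surj y => /le_locset FG /eta_setE AG; apply/eta_setE.
exact: missed_by_prec FG AG.
Qed.

(** For a closed subset of an Alexandrov space, irreducible means nonempty and directed; the union
    of [F] and [G] provides the upper bound. *)
Lemma eta_irr A : irreducible_set (eta_set A).
Proof.
apply/(alexandrov_irreducible (@eta_closed A)); split.
  by exists (R_ fset0); apply/eta_setE.
move=> x y; have [F ->] := locset_surj x; have [G ->] := locset_surj y.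
move=> /eta_setE AF /eta_setE AG; exists (locset_class (F `|` G)%fset); split.
- by apply/eta_setE => f; rewrite in_fsetU => /orP[/AF|/AG].
- by apply/le_locset => f fF; apply: loc_map_unit; rewrite in_fsetU fF.
- by apply/le_locset => f fG; apply: loc_map_unit; rewrite in_fsetU fG orbT.
Qed.

Definition eta_fun (q : E_obj (Spec_obj R)) : NCSpec_obj R :=
  Sober (@eta_closed (repr q)) (@eta_irr (repr q)).

(** The choice of representative in [eta_fun] is harmless, since equivalent sets of primes lie in
    the same [D_ f]. *)
Lemma eta_funE A F :
  sober_set (eta_fun (@E_class (Spec_obj R) A)) (R_ F) <-> missed_by A F.
Proof.
apply: iff_trans (eta_setE _ _) _; set A' := repr _.
have /pow_equivP h : @pow_equiv (Spec_obj R) A' A.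
  by apply/E_classP; rewrite /A' /E_class reprK.
by split=> AF f /AF; rewrite (h (@D_ R f)) //; exists f.
Qed.

Lemma NCSpec_ext (C D : NCSpec_obj R) :
  (forall F, sober_set C (R_ F) <-> sober_set D (R_ F)) -> C = D.
Proof.
move=> CD; apply: sober_eq; apply/seteqP.
by split=> x; have [F ->] := locset_surj x; apply CD.
Qed.

Lemma eta_fun_base (V : set (NCSpec_obj R)) : tbase V -> tbase (eta_fun @^-1` V).
Proof.
move=> [f _ <-]; have bf : @tbase (Spec_obj R) (@D_ R f) by exists f.
exists (@D_ R f) => //; apply/seteqP; split=> q; have [A ->] := E_class_surj q.
  by move/(E_boxE A bf) => Af; apply/NCSpec_hitP/eta_funE/missed_by1.
by move/NCSpec_hitP/eta_funE/missed_by1 => Af; apply/E_boxE.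
Qed.

Definition eta : thom (E_obj (Spec_obj R)) (NCSpec_obj R) := THom eta_fun_base.

(** The intersection of the [D_ f] with [R_f] in [C], hence the largest representative of the class
    corresponding to [C]. *)
Definition avoiding (C : NCSpec_obj R) : set (Spec R) :=
  [set P | forall f, sober_set C (R_ [fset f]%fset) -> ~ spec_set P f].

(** The set [M] of all [g] with [R_g] in [C] is multiplicative and saturated. If [f] is not in [M],
    then by saturation the ideal [Rf] is disjoint from [M], and a prime containing [Rf] and disjoint
    from [M] lies in [avoiding C] but not in [D_ f]. *)
Lemma avoiding_subD (C : NCSpec_obj R) (f : R) :
  avoiding C `<=` @D_ R f <-> sober_set C (R_ [fset f]%fset).
Proof.
split=> [sub|Cf P]; last by apply.
pose M := [set g : R | sober_set C (R_ [fset g]%fset)].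
have M1 : M 1.
  have [[x Cx] _] := sober_irr C; have [F xE] := locset_surj x.
  rewrite xE in Cx; apply: NCSpec_down Cx; apply/loc_prec1.
  by rewrite rmorph1; exists 1; rewrite !mulr1.
have Mdiv (g h : R) : M (g * h) -> M h.
  apply: NCSpec_down; apply/loc_prec1.
  suff /is_unit_mapM [] : is_unit (loc_map [fset g * h]%fset (g * h)) by [].
  by apply: loc_map_unit; rewrite inE.
have MM g h : M g -> M h -> M (g * h).
  move=> Mg Mh; have := NCSpec_directed Mg Mh; apply: NCSpec_down.
  apply/loc_prec1/is_unit_mapM.
  by split; apply: loc_map_unit; rewrite !inE eqxx ?orbT.
apply: contrapT => nMf.
have Jid : ideal [set a * f | a in [set: R]].
  split; first by exists 0; rewrite ?mul0r.
    by move=> _ _ [a _ <-] [b _ <-]; exists (a + b); rewrite ?mulrDl.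
  by move=> b _ [a _ <-]; exists (b * a); rewrite ?mulrA.
have [|P [fP PM0]] := exists_prime_disjoint M1 MM Jid.
  by apply/seteqP; split=> // _ [[a _ <-] /Mdiv].
apply: (sub P); last by apply: fP; exists 1; rewrite ?mul1r.
by move=> g Mg Pg; have : (P `&` M) g by []; rewrite PM0.
Qed.

Definition eta_inv_fun (C : NCSpec_obj R) : E_obj (Spec_obj R) :=
  @E_class (Spec_obj R) (avoiding C).

Lemma eta_inv_fun_base (V : set (E_obj (Spec_obj R))) :
  tbase V -> tbase (eta_inv_fun @^-1` V).
Proof.
move=> [_ [f _ <-] <-]; exists f => //.
have bf : @tbase (Spec_obj R) (@D_ R f) by exists f.
apply/seteqP; split=> C.
  by move=> /NCSpec_hitP /avoiding_subD Cf; apply/(@E_boxE (Spec_obj R)).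
by move=> /(@E_boxE (Spec_obj R) _ _ bf) /avoiding_subD Cf; apply/NCSpec_hitP.
Qed.

Definition eta_inv : thom (NCSpec_obj R) (E_obj (Spec_obj R)) :=
  THom eta_inv_fun_base.

Lemma eta_iso : tiso eta.
Proof.
exists eta_inv; split; apply: thom_eq.
  move=> q; have [A ->] := E_class_surj q; apply/E_classP/pow_equivP.
  move=> _ [f _ <-]; apply: iff_trans (avoiding_subD _ f) _.
  by rewrite eta_funE missed_by1.
(* By commutativity every [R_F] is some [R_f], so comparing the two closed sets at singletons
   suffices. *)
move=> C; apply: NCSpec_ext => F; have [f ->] := LR_principal F.
by rewrite eta_funE missed_by1 avoiding_subD.
Qed.

End Eta.

(** The preimage of [P] under [theta] is disjoint from [F] exactly when [P] is disjoint from the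
    image of [F]. *)
Lemma eta_natural (R S : comPzRingType) (theta : {rmorphism R -> S}) :
  tcomp (eta R) (E_map (Spec_map theta)) = tcomp (NCSpec_map theta) (eta S).
Proof.
apply: thom_eq => q; have [A ->] := E_class_surj q; apply: NCSpec_ext => F.
rewrite /= E_funE; apply: iff_trans (eta_funE _ _) (iff_sym _).
apply: iff_trans (NCSpec_fun_setE _ _ _) _; rewrite eta_funE; split=> AF.
  by move=> f fF _ [P AP <-]; apply: AF AP; apply: in_imfset.
move=> _ /imfsetP[f /= fF ->] P AP.
by suff : D_ f (Spec_fun theta P) by []; apply: (AF f fF); exists P.
Qed.

Theorem proposition8p8 :
  exists eta : forall R : comPzRingType, thom (E_obj (Spec_obj R)) (NCSpec_obj R),
    (forall R : comPzRingType, tiso (eta R)) /\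
    (forall (R S : comPzRingType) (theta : {rmorphism R -> S}),
       tcomp (eta R) (E_map (Spec_map theta)) =
       tcomp (NCSpec_map theta) (eta S)).
Proof. by exists eta; split; [exact: eta_iso|exact: eta_natural]. Qed.
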